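(* Let $L_0\subset\mu_{q^n+1}$, $L_1\subset S_\ell\times C_m$ and $\bar L\subset M_\ell$ be subgroups satisfying $\bar\rho(\bar L)=L_0^m$ (where $L_0^m=\{\xi^m:\xi\in L_0\}$), $\bar L\cap S_\ell=\pi(L_1)$, and $\rho(L_1)=L_0\cap\mu_m$. Moreover, assume that $L_1\cap C_m=\{\alpha_{1,0,\xi} : \xi\in L_0\cap\mu_m\}$. Then there exists a subgroup $L\subset\mathrm{Aut}(K_n)$ such that $\rho(L)=L_0$, $L\cap(S_\ell\times C_m)=L_1$, and $\pi(L)=\bar L$.
   Context: Let $p$ be a prime, $q=p^h$ with $h\ge 1$, $n\ge 1$ odd, $m=(q^n+1)/(q+1)$, and let $\mathbb K$ be the algebraic closure of $\mathbb F_{q^{2n}}$. Let $K_n=\mathbb K(x,y,z)$ with $y^{q+1}=x^{q+1}-1$ and $z^m=y\,\frac{x^{q^2}-x}{x^{q+1}-1}$, and let $H=\mathbb K(x,y)\subset K_n$. $\mathrm{Aut}(K_n)$ denotes the group $\{\alpha_{a,c,\xi} : a,c\in\mathbb F_{q^2},\ a^{q+1}-c^{q+1}=1,\ \xi^{q^n+1}=1\}$, where $\alpha_{a,c,\xi}(x)=ax+c^q\xi^m y$, $\alpha_{a,c,\xi}(y)=cx+a^q\xi^m y$, $\alpha_{a,c,\xi}(z)=\xi z$. The map $\pi:\mathrm{Aut}(K_n)\to\mathrm{Aut}(H)$ is restriction to $H$; $\pi(\alpha_{a,c,\xi})$ depends only on $a,c,\xi^m$ and is denoted $\beta_{a,c,\xi^m}$.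 Put $M_\ell=\pi(\mathrm{Aut}(K_n))=\{\beta_{a,c,\tau}: a,c\in\mathbb F_{q^2},\ a^{q+1}-c^{q+1}=1,\ \tau^{q+1}=1\}$. Let $C_m=\ker\pi=\{\alpha_{1,0,\xi}:\xi^m=1\}$ and $S_\ell=\{\alpha_{a,c,1}\}$, a normal subgroup isomorphic to $\mathrm{SL}(2,q)$; since $\pi$ is injective on it, $S_\ell$ is identified with $\pi(S_\ell)=\{\beta_{a,c,1}\}\subset M_\ell$. The subgroup generated by $S_\ell$ and the central subgroup $C_m$ is the direct product $S_\ell\times C_m$. For $k\mid q^n+1$, $\mu_k\subset\mathbb F_{q^{2n}}^*$ is the cyclic subgroup of order $k$. Define $\rho:\mathrm{Aut}(K_n)\to\mu_{q^n+1}$, $\rho(\alpha_{a,c,\xi})=\xi$, and $\bar\rho:M_\ell\to\mu_{q+1}$, $\bar\rho(\beta_{a,c,\zeta})=\zeta$. *)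

(* Defs.v *)
From HB Require Import structures.
From mathcomp Require Import all_boot all_order all_fingroup all_algebra all_field.
From mathcomp Require Import boolp classical_sets.

Set Implicit Arguments.
Unset Strict Implicit.
Unset Printing Implicit Defensive.

Import GRing.Theory.
Local Open Scope classical_set_scope.
Local Open Scope ring_scope.

Definition subgroup (G : groupType) (A : set G) : Prop := group_closed [in A].

Definition gen_subgroup (G : groupType) (A : set G) : set G :=
  smallest (@subgroup G) A.

Definition subfield (E : fieldType) (A : set E) : Prop :=
  GRing.divring_closed [in A].

Definition gen_subfield (E : fieldType) (A : set E) : set E :=
  smallest (@subfield E) A.

Lemma gen_subfield_closed (E : fieldType) (A : set E) :
  GRing.divring_closed [in gen_subfield A].
Proof.
split.
- by apply/mem_set => B [[B1 _ _] _]; apply: set_mem B1.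
- move=> u v /set_mem gu /set_mem gv; apply/mem_set => B BP.
  have [_ Bsub _] := BP.1.
  by apply: set_mem (Bsub _ _ (mem_set (gu B BP)) (mem_set (gv B BP))).
- move=> u v /set_mem gu /set_mem gv; apply/mem_set => B BP.
  have [_ _ Bdiv] := BP.1.
  by apply: set_mem (Bdiv _ _ (mem_set (gu B BP)) (mem_set (gv B BP))).
Qed.

Section GenField.
Variables (E : fieldType) (A : set E).

Definition in_gen_subfield : {pred E} := [in gen_subfield A].

HB.instance Definition _ := GRing.isDivringClosed.Build E in_gen_subfield
  (gen_subfield_closed A).

Record gen_field := GenField {
  gen_field_val : E;
  _ : gen_field_val \in in_gen_subfield }.

HB.instance Definition _ := [isSub for gen_field_val].
HB.instance Definition _ := [Choice of gen_field by <:].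
HB.instance Definition _ := [SubChoice_isSubComUnitRing of gen_field by <:].
HB.instance Definition _ :=
  [SubComUnitRing_isSubIntegralDomain of gen_field by <:].
HB.instance Definition _ := [SubIntegralDomain_isSubField of gen_field by <:].

End GenField.

Section FixAut.
Variables (E : fieldType) (B : set E).

Definition is_fixaut (f : E -> E) : Prop :=
  [/\ zmod_morphism f, monoid_morphism f, bijective f
    & forall u, B u -> f u = u].

Record fixaut := FixAut { fixaut_fun :> E -> E; _ : `[< is_fixaut fixaut_fun >] }.

HB.instance Definition _ := [isSub for fixaut_fun].
HB.instance Definition _ := [Choice of fixaut by <:].

Lemma fixautP (s : fixaut) : is_fixaut s.
Proof. by case: s => f /= /asboolP. Qed.

Lemma fixaut_eqP (s t : fixaut) : s =1 t -> s = t.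
Proof. by move=> st; apply: val_inj; apply: funext. Qed.

Fact fixaut_one_subproof : `[< is_fixaut id >].
Proof. by apply/asboolP; split=> //; exists id. Qed.

Definition fixaut_one := FixAut fixaut_one_subproof.

Fact fixaut_mul_subproof (s t : fixaut) : `[< is_fixaut (s \o t) >].
Proof.
have [sB [s1 sM] sbij sfix] := fixautP s.
have [tB [t1 tM] tbij tfix] := fixautP t.
apply/asboolP; split.
- by move=> u v /=; rewrite tB sB.
- by split=> [|u v] /=; rewrite ?t1 // tM sM.
- exact: bij_comp.
- by move=> u Bu /=; rewrite tfix // sfix.
Qed.

Definition fixaut_mul s t := FixAut (fixaut_mul_subproof s t).

Lemma fixaut_bij (s : fixaut) : bijective s.
Proof. by case: (fixautP s). Qed.

Lemma fixaut_inv_ex (s : fixaut) : exists g, cancel s g /\ cancel g s.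
Proof. by case: (fixaut_bij s) => g sK gK; exists g. Qed.

Definition fixaut_inv_fun (s : fixaut) : E -> E := sval (cid (fixaut_inv_ex s)).

Lemma fixautK (s : fixaut) : cancel s (fixaut_inv_fun s).
Proof. by rewrite /fixaut_inv_fun; case: cid => g []. Qed.

Lemma fixautVK (s : fixaut) : cancel (fixaut_inv_fun s) s.
Proof. by rewrite /fixaut_inv_fun; case: cid => g []. Qed.

Fact fixaut_inv_subproof (s : fixaut) : `[< is_fixaut (fixaut_inv_fun s) >].
Proof.
have [sB [s1 sM] sbij sfix] := fixautP s; apply/asboolP; split.
- by move=> u v; apply: (bij_inj sbij); rewrite sB !fixautVK.
- split=> [|u v]; apply: (bij_inj sbij); first by rewrite fixautVK s1.
  by rewrite sM !fixautVK.
- by exists s; [apply: fixautVK | apply: fixautK].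
- by move=> u Bu; apply: (bij_inj sbij); rewrite fixautVK sfix.
Qed.

Definition fixaut_inv s := FixAut (fixaut_inv_subproof s).

Fact fixaut_mulA : associative fixaut_mul.
Proof. by move=> s t r; apply: fixaut_eqP. Qed.

Fact fixaut_mul1 : left_id fixaut_one fixaut_mul.
Proof. by move=> s; apply: fixaut_eqP. Qed.

Fact fixaut_mulr1 : right_id fixaut_one fixaut_mul.
Proof. by move=> s; apply: fixaut_eqP. Qed.

Fact fixaut_mulV : left_inverse fixaut_one fixaut_inv fixaut_mul.
Proof. by move=> s; apply: fixaut_eqP => u; apply: fixautK. Qed.

Fact fixaut_mulrV : right_inverse fixaut_one fixaut_inv fixaut_mul.
Proof. by move=> s; apply: fixaut_eqP => u; apply: fixautVK. Qed.

HB.instance Definition _ := isGroup.Build fixaut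
  fixaut_mulA fixaut_mul1 fixaut_mulr1 fixaut_mulV fixaut_mulrV.

End FixAut.

Definition mexp (q n : nat) : nat := (q ^ n + 1) %/ (q + 1).

(* Since [x] is transcendental, the two equations determine the field [Kn]
   generated by [K], [x], [y] and [z] up to isomorphism: they are irreducible
   over K(x) and K(x, y), both being totally ramified above the places where
   x ^ (q + 1) = 1. *)
Record Kn_field (q n : nat) (K : fieldType) := KnField {
  Kn :> fieldType;
  Kn_const : {rmorphism K -> Kn};
  Kn_x : Kn;
  Kn_y : Kn;
  Kn_z : Kn;
  Kn_x_transcendental : ~ algebraicOver Kn_const Kn_x;
  Kn_y_eq : Kn_y ^+ (q + 1) = Kn_x ^+ (q + 1) - 1;
  Kn_z_eq : Kn_z ^+ mexp q n =
    Kn_y * ((Kn_x ^+ (q ^ 2) - Kn_x) / (Kn_x ^+ (q + 1) - 1));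
  Kn_generated :
    gen_subfield (range Kn_const `|` [set Kn_x; Kn_y; Kn_z]) = [set: Kn] }.

Section Automorphisms.
(* [F] plays the part of the field of order q ^ (2 * n), and [j] embeds it in
   its algebraic closure [K]. *)
Variables (q n : nat) (F : finFieldType) (K : fieldType).
Variables (j : {rmorphism F -> K}) (KF : Kn_field q n K).

Local Notation m := (mexp q n).
Local Notation x := (Kn_x KF).
Local Notation y := (Kn_y KF).
Local Notation z := (Kn_z KF).

Definition Kconst : set KF := range (Kn_const KF).
Definition Fconst (a : F) : KF := Kn_const KF (j a).

Definition Fq2 : set F := [set a | a ^+ (q ^ 2) = a].

Definition mu (k : nat) : set {unit F} := [set u | (u ^+ k = 1)%g].

Definition HF : fieldType := gen_field (Kconst `|` [set x; y]).

Lemma xH_subproof : x \in gen_subfield (Kconst `|` [set x; y]).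
Proof. by apply: mem_set; apply: sub_gen_smallest; right; left. Qed.

Lemma yH_subproof : y \in gen_subfield (Kconst `|` [set x; y]).
Proof. by apply: mem_set; apply: sub_gen_smallest; right; right. Qed.

Definition xH : HF := GenField xH_subproof.
Definition yH : HF := GenField yH_subproof.

Lemma FconstH_subproof (a : F) :
  Fconst a \in gen_subfield (Kconst `|` [set x; y]).
Proof. by apply: mem_set; apply: sub_gen_smallest; left; exists (j a). Qed.

Definition FconstH (a : F) : HF := GenField (FconstH_subproof a).

Definition KautKn : groupType := fixaut Kconst.
Definition KautH : groupType := fixaut [set u : HF | Kconst (val u)].

(* A K-automorphism is determined by its values at x, y and z; [is_alpha]
   does not include the conditions on the parameters a, c, xi. *)
Definition is_alpha (a c : F) (xi : {unit F}) (s : KautKn) : Prop :=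
  [/\ s x = Fconst a * x + Fconst (c ^+ q * val xi ^+ m) * y,
      s y = Fconst c * x + Fconst (a ^+ q * val xi ^+ m) * y
    & s z = Fconst (val xi) * z].

Definition is_beta (a c : F) (tau : {unit F}) (b : KautH) : Prop :=
  b xH = FconstH a * xH + FconstH (c ^+ q * val tau) * yH /\
  b yH = FconstH c * xH + FconstH (a ^+ q * val tau) * yH.

Definition ac_param (a c : F) : Prop :=
  [/\ Fq2 a, Fq2 c & a ^+ (q + 1) - c ^+ (q + 1) = 1].

Definition AutKn : set KautKn :=
  [set s | exists a c xi,
     [/\ ac_param a c, mu (q ^ n + 1) xi & is_alpha a c xi s]].

(* Every element of [AutKn] restricts to a unique automorphism of [HF]; the
   default value 1 is only taken outside [AutKn]. *)
Definition piH (s : KautKn) : KautH :=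
  xget (1%g : KautH) [set b | forall u : HF, val (b u) = s (val u)].

Definition Ml : set KautH := piH @` AutKn.

Definition Cm : set KautKn := [set s | AutKn s /\ piH s = 1%g].

Definition Sl : set KautKn :=
  [set s | exists a c, ac_param a c /\ is_alpha a c 1%g s].

(* [Cm] is central and meets [Sl] trivially, so this is the internal direct
   product of [Sl] and [Cm]. *)
Definition SlCm : set KautKn := gen_subgroup (Sl `|` Cm).

(* On [AutKn] and [Ml] the parameters xi and zeta are determined by the
   automorphism; the default value 1 is only taken outside these groups. *)
Definition rho (s : KautKn) : {unit F} :=
  xget (1%g : {unit F}) [set xi | exists a c,
    [/\ ac_param a c, mu (q ^ n + 1) xi & is_alpha a c xi s]].

Definition rhobar (b : KautH) : {unit F} :=
  xget (1%g : {unit F}) [set zeta | exists a c,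
    [/\ ac_param a c, mu (q + 1) zeta & is_beta a c zeta b]].

End Automorphisms.

Arguments AutKn {q n F K} j KF.
Arguments Ml {q n F K} j KF.
Arguments Cm {q n F K} j KF.
Arguments Sl {q n F K} j KF.
Arguments SlCm {q n F K} j KF.
Arguments piH {q n K KF} s.
Arguments rho {q n F K} j {KF} s.
Arguments rhobar {q n F K} j {KF} b.

(* Main.v *)
From HB Require Import structures.
Require Import Defs.
From mathcomp Require Import all_boot all_order all_fingroup all_algebra all_field.
From mathcomp Require Import ring zify.
From mathcomp Require Import boolp classical_sets.

(** The group L consists of the automorphisms s with rho(s) in L0 and pi(s) in
Lbar. If such an s lies in Sl x Cm, then pi(s) = pi(t) for some t in L1, and
t^-1 s lies in Cm with rho(t^-1 s) in L0 and mu_m, hence in L1; so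
L meets Sl x Cm in L1. For rho(L) = L0 and pi(L) = Lbar, an element of Lbar with
rhobar equal to xi^m is pi(alpha_{a,c,xi'}) with xi'^m = xi^m, and one corrects
xi' to xi by composing with alpha_{1,0,xi/xi'}.

This needs alpha_{1,0,zeta} to exist for every m-th root of unity zeta. Put
N = m(q + 1) = q^n + 1. Then z^N is a polynomial in x with a simple zero at
x = 1 and y is z^m divided by a polynomial in x, so that Kn = K(x)(z) is totally
ramified of degree N over the place x = 1. Hence 1, z, ..., z^(N-1) are
independent over K[x], and a polynomial relation between x and z
is preserved when z is replaced by zeta z. *)

Set Implicit Arguments.
Unset Strict Implicit.
Unset Printing Implicit Defensive.

Import GRing.Theory FinRing.Theory.
Local Open Scope classical_set_scope.
Local Open Scope ring_scope.

(** * Radical extensions of K(x) *)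

Section RadicalExtension.
Variables (K E : fieldType) (f : {rmorphism K -> E}) (x : E).
Hypothesis x_transc : ~ algebraicOver f x.

Definition evalx : {poly K} -> E := horner_morph (fun a => mulrC x (f a)).
HB.instance Definition _ := GRing.RMorphism.on evalx.

(** Transcendence of [x] enters here: [evalx] embeds [K[X]] in [E], so relations over [K[x]] can be
    studied on polynomials. *)
Lemma evalx_eq0 (p : {poly K}) : (evalx p == 0) = (p == 0).
Proof.
apply/idP/idP => [px0|/eqP->]; last by rewrite rmorph0.
by apply: contraT => p0; case: x_transc; exists p.
Qed.

Lemma evalxC (a : K) : evalx a%:P = f a.
Proof. exact: horner_morphC. Qed.

Lemma evalxX : evalx 'X = x.
Proof. exact: horner_morphX. Qed.

Definition evalxz (z : E) : {poly {poly K}} -> E :=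
  horner_morph (fun p => mulrC z (evalx p)).
HB.instance Definition _ (z : E) := GRing.RMorphism.on (evalxz z).

Lemma evalxzC (z : E) (p : {poly K}) : evalxz z p%:P = evalx p.
Proof. exact: horner_morphC. Qed.

Lemma evalxzX (z : E) : evalxz z 'X = z.
Proof. exact: horner_morphX. Qed.

Variables (N' : nat) (F F1 : {poly K}) (r : K) (z : E).
Local Notation N := N'.+1.
Hypothesis F_eq : F = ('X - r%:P) * F1.
Hypothesis F1r : ~~ root F1 r.
Hypothesis z_eq : z ^+ N = evalx F.

Lemma F1_neq0 : F1 != 0.
Proof. by apply: contraNneq F1r => ->; rewrite root0. Qed.

Lemma radical_neq0 : z != 0.
Proof.
apply/eqP => z0; have /eqP := z_eq; rewrite z0 expr0n /= eq_sym evalx_eq0 F_eq.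
by rewrite mulf_eq0 polyXsubC_eq0 (negPf F1_neq0).
Qed.

(* The determinant of multiplication by [\sum_i p i z^i] vanishes; modulo
   [X - r], where [z^N] becomes 0, its matrix is triangular with diagonal
   entries [p 0]. *)
Lemma relation_root (p : 'I_N -> {poly K}) :
  \sum_i evalx (p i) * z ^+ i = 0 -> root (p ord0) r.
Proof.
move=> rel0.
(* Column [k] lists the coefficients of [z^k] times the relation. The index [l - k] is taken modulo
   [N]; [l < k] is the wrap-around case, where [z^N = F] contributes a factor. *)
pose A := \matrix_(l < N, k < N) (F ^+ (l < k)%N * p (l - k)).
have detA0 : \det A = 0.
  apply/eqP; rewrite -evalx_eq0 -det_map_mx; apply/det0P.
  exists (\row_l z ^+ l).
    apply/eqP => /rowP/(_ ord0); rewrite !mxE => /eqP.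
    by rewrite expr0 oner_eq0.
  apply/rowP => k; rewrite !mxE (reindex_inj (addIr k)) /=.
  transitivity ((\sum_i evalx (p i) * z ^+ i) * z ^+ k); last by rewrite rel0 mul0r.
  rewrite mulr_suml; apply: eq_bigr => i _.
  rewrite !mxE addrK rmorphM rmorphXn /= -z_eq -exprM mulrA -exprD.
  rewrite -mulrA -exprD mulrC; congr (_ * z ^+ _).
  have [ltN|leN] := ltnP (i + k) N.
    by rewrite modn_small // ltnNge leq_addl muln0 addn0.
  have lt2 : (i + k - N < N)%N by rewrite ltn_subLR // -addnS leq_add // ltnW.
  have -> : ((i + k) %% N = i + k - N)%N.
    by rewrite -{1}(subnK leN) modnDr modn_small.
  by rewrite ltn_subLR // ltn_add2r ltn_ord muln1 subnK.
have := congr1 (horner^~ r) detA0; rewrite /= horner0.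
rewrite -[LHS]/(horner_eval r _) -det_map_mx det_trig; last first.
  apply/is_trig_mxP => l k lk; rewrite !mxE lk expr1 F_eq.
  by rewrite !rmorphM /= /horner_eval hornerXsubC subrr !mul0r.
move/eqP; rewrite prodf_seq_eq0 => /hasP[k _ /=].
by rewrite !mxE ltnn mul1r subrr.
Qed.

(* Divide by [z], using [(X - r) F1 = z^N]: this lowers the [z]-order by one. *)
Definition shift_relation (p : nat -> {poly K}) (i : nat) : {poly K} :=
  if (i < N')%N then p i.+1 * F1 else p 0%N %/ ('X - r%:P).

(** By [relation_root] the constant term is divisible by [X - r]; after multiplication by [F1] it is
    a multiple of [F = z^N], so the nonzero [z] can be cancelled. *)
Lemma relation_shift (p : nat -> {poly K}) :
  \sum_(i < N) evalx (p i) * z ^+ i = 0 ->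
  \sum_(i < N) evalx (shift_relation p i) * z ^+ i = 0.
Proof.
move=> rel0; have /factor_theorem[p0 p0E] := relation_root rel0.
apply: (mulIf radical_neq0); rewrite mul0r.
transitivity (evalx F1 * \sum_(i < N) evalx (p i) * z ^+ i); last first.
  by rewrite rel0 mulr0.
rewrite big_ord_recr /= mulrDl.
rewrite [in RHS]big_ord_recl mulrDr [RHS]addrC; congr (_ + _).
  rewrite mulr_suml mulr_sumr; apply: eq_bigr => i _.
  rewrite /shift_relation ltn_ord -mulrA -exprSr lift0 rmorphM /=.
  by rewrite mulrAC mulrC.
rewrite /shift_relation ltnn -mulrA -exprSr z_eq F_eq p0E mulpK ?polyXsubC_eq0 //.
by rewrite !rmorphM /= expr0 mulr1 [in RHS]mulrC mulrA.
Qed.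

(** [M * N + i] is the order of [(x - r)^M z^i] at the place above [x = r]. A shift lowers it by
    one, from [(M, i + 1)] to [(M, i)] or from [(M + 1, 0)] to [(M, N - 1)]; [t] bounds it for the
    induction. *)
Lemma relation_dvd (t : nat) (p : nat -> {poly K}) (i M : nat) :
    \sum_(i < N) evalx (p i) * z ^+ i = 0 ->
  (i < N)%N -> (M * N + i < t)%N -> ('X - r%:P) ^+ M.+1 %| p i.
Proof.
elim: t p i M => // t IHt p i M rel0 ltiN ltt.
have /factor_theorem[p0 p0E] := relation_root rel0.
have rel1 := relation_shift rel0.
case: i => [|i] in ltiN ltt *.
  case: M ltt => [|M] ltt; first by rewrite expr1 dvdp_XsubCl (relation_root rel0).
  have := IHt _ N' M rel1 (ltnSn _).
  rewrite /shift_relation ltnn p0E mulpK ?polyXsubC_eq0 // => dvd0.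
  rewrite exprSr dvdp_mul2r ?polyXsubC_eq0 //; apply: dvd0.
  by move: ltt; rewrite addn0 mulSn addnC addnS ltnS.
have := IHt _ i M rel1 (ltnW ltiN).
(* The factor [F1] brought in by the shift is prime to [X - r]. *)
rewrite /shift_relation; rewrite ltnS in ltiN; rewrite ltiN Gauss_dvdpl.
  by apply; move: ltt; rewrite addnS ltnS.
by rewrite coprimep_expl // coprimep_sym coprimep_XsubC.
Qed.

Lemma relation_eq0 (p : nat -> {poly K}) (i : nat) :
    \sum_(i < N) evalx (p i) * z ^+ i = 0 -> (i < N)%N -> p i = 0.
Proof.
move=> rel0 ltiN; apply/eqP/contraT => pi0.
have := relation_dvd (M := size (p i)) rel0 ltiN (ltnSn _).
move/(dvdp_leq pi0); rewrite size_exp_XsubC => lt.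
by have := leq_trans (leqnSn _) lt; rewrite ltnn.
Qed.

(** The remainder of [P] modulo the monic [X^N - F] has the same value as [P] at every [N]-th root
    of [F(x)], in particular at [z] and [zeta z]; by [relation_eq0] it is zero. *)
Lemma evalxz_ker (zeta : E) (P : {poly {poly K}}) :
  zeta ^+ N = 1 -> evalxz z P = 0 -> evalxz (zeta * z) P = 0.
Proof.
move=> zetaN Pz0.
have Dmon : 'X^N - F%:P \is monic by apply: monicXnsubC.
have PE := Pdiv.RingMonic.rdivp_eq Dmon P.
set R := Pdiv.CommonRing.rmodp _ _ in PE.
have Dz0 (w : E) : w ^+ N = evalx F -> evalxz w P = evalxz w R.
  move=> wN; rewrite {1}PE rmorphD rmorphM /= rmorphB rmorphXn /= evalxzX.
  by rewrite evalxzC wN subrr mulr0 add0r.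
rewrite (Dz0 z z_eq) in Pz0; rewrite Dz0 ?exprMn ?zetaN ?mul1r //.
have sizeR : (size R <= N)%N.
  have := Pdiv.CommonRing.ltn_rmodpN0 P (monic_neq0 Dmon).
  by rewrite size_XnsubC.
suff -> : R = 0 by rewrite rmorph0.
apply/polyP => i; rewrite coef0; have [ltiN|] := ltnP i N; last first.
  by move=> leN; rewrite nth_default // (leq_trans sizeR).
apply: (relation_eq0 _ ltiN); rewrite -[RHS]Pz0 /evalxz /horner_morph.
rewrite (@horner_coef_wide _ N) ?(leq_trans (size_poly _ _)) //.
by apply: eq_bigr => k _; rewrite coef_map.
Qed.

End RadicalExtension.

(** * Automorphisms from two presentations of a field by fractions *)

Definition fractions (A : comNzRingType) (E : fieldType) (e : {rmorphism A -> E}) :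
    set E :=
  [set u | exists a b, e b != 0 /\ u = e a / e b].

Lemma fractions_subfield (A : comNzRingType) (E : fieldType)
  (e : {rmorphism A -> E}) : subfield (fractions e).
Proof.
split.
- by apply/mem_set; exists 1, 1; rewrite rmorph1 divr1 oner_neq0.
- move=> _ _ /set_mem[a [b [b0 ->]]] /set_mem[c [d [d0 ->]]].
  apply/mem_set; exists (a * d - c * b), (b * d).
  rewrite rmorphB !rmorphM mulf_neq0 //; split=> //.
  by rewrite -[- (e c / e d)]mulNr addf_div // mulNr.
- move=> _ _ /set_mem[a [b [b0 ->]]] /set_mem[c [d [d0 ->]]].
  (* If the divisor is zero, the quotient is 0 by convention. *)
  apply/mem_set; have [c0|c_neq0] := eqVneq (e c) 0.
    by exists 0, 1; rewrite c0 !(mul0r, invr0, mulr0) rmorph1 rmorph0 mul0r oner_neq0.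
  by exists (a * d), (b * c); rewrite !rmorphM mulf_neq0 // invf_div mulf_div.
Qed.

Lemma fractions_image (A : comNzRingType) (E : fieldType)
  (e : {rmorphism A -> E}) (a : A) : fractions e (e a).
Proof. by exists a, 1; rewrite rmorph1 divr1 oner_neq0. Qed.

(** [E] is the fraction field of the same quotient of [A] in two ways, so [e a / e b] can be sent to
    [e' a / e' b]; exchanging [e] and [e'] gives the inverse map. *)
Lemma fraction_automorphism (A : comNzRingType) (E : fieldType)
    (e e' : {rmorphism A -> E}) :
    (forall a, e a = 0 <-> e' a = 0) ->
    (forall u, fractions e u) ->
    (forall u, fractions e' u) ->
  exists s : E -> E,
    [/\ zmod_morphism s, monoid_morphism s, bijective s & forall a, s (e a) = e' a].
Proof.
wlog suff main : e e' / (forall a, e a = 0 <-> e' a = 0) ->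
    (forall u, fractions e u) ->
    exists s : E -> E, forall a b, e b != 0 -> s (e a / e b) = e' a / e' b.
  move=> ker_ee' frac frac'.
  have [s sE] := main e e' ker_ee' frac.
  have [t tE] := main e' e (fun a => iff_sym (ker_ee' a)) frac'.
  have nz a : e a != 0 -> e' a != 0 by apply: contra_neq => /ker_ee'.
  have nz' a : e' a != 0 -> e a != 0 by apply: contra_neq => /ker_ee'.
  have sA a : s (e a) = e' a.
    have := sE a 1; rewrite !rmorph1 !divr1; apply; exact: oner_neq0.
  exists s; split => //.
  - move=> u v; have [a [b [b0 ->]]] := frac u; have [c [d [d0 ->]]] := frac v.
    have -> : e a / e b - e c / e d = e (a * d - c * b) / e (b * d).
      by rewrite rmorphB !rmorphM /= -[- (e c / e d)]mulNr addf_div // mulNr.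
    rewrite !sE ?rmorphM ?mulf_neq0 // rmorphB !rmorphM /=.
    by rewrite -[- (e' c / e' d)]mulNr addf_div ?nz // mulNr.
  - split; first by rewrite -[1 in LHS](rmorph1 e) sA rmorph1.
    move=> u v; have [a [b [b0 ->]]] := frac u; have [c [d [d0 ->]]] := frac v.
    by rewrite mulf_div -!rmorphM !sE ?rmorphM ?mulf_neq0 //= mulf_div.
  - exists t => u.
      by have [a [b [b0 ->]]] := frac u; rewrite sE // tE // nz.
    by have [a [b [b0 ->]]] := frac' u; rewrite tE // sE // nz'.
move=> ker_ee' frac.
have [s sP] : {s : E -> E & forall u,
    exists a b, [/\ e b != 0, u = e a / e b & s u = e' a / e' b]}.
  apply: (@choice _ _ (fun u v => exists a b,
    [/\ e b != 0, u = e a / e b & v = e' a / e' b])) => u.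
  by have [a [b [b0 uE]]] := frac u; exists (e' a / e' b), a, b.
exists s => a b b0; have [c [d [d0 eqf ->]]] := sP (e a / e b).
have nz x : e x != 0 -> e' x != 0 by apply: contra_neq => /ker_ee'.
(* Independence of the chosen fraction: [e'] has to kill [c * b - a * d], and it does because [e]
   does. *)
apply/eqP; rewrite eqr_div ?nz // -!rmorphM -subr_eq0 -rmorphB.
apply/eqP/ker_ee'; rewrite rmorphB !rmorphM /=; apply/eqP.
by rewrite subr_eq0 -eqr_div // eqf.
Qed.

(** * Existence of alpha_{1,0,zeta} *)

Lemma mexpM (q n : nat) : (0 < q)%N -> odd n -> (mexp q n * (q + 1) = q ^ n + 1)%N.
Proof.
move=> q_gt0 n_odd; rewrite /mexp divnK //.
rewrite -(odd_double_half n) n_odd add1n; elim: n./2 => [|k IHk]; first by rewrite expn1.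
(* The added multiple of [q + 1] is [q^2 - 1], which turns the sum into [q^2] times the previous
   case. *)
rewrite -(dvdn_addl (n := (q - 1) * (q + 1)%N)) ?dvdn_mull //.
have -> : (q ^ k.+1.*2.+1 + 1 + (q - 1) * (q + 1) = q ^ 2 * (q ^ k.*2.+1 + 1))%N.
  have -> : k.+1.*2.+1 = (2 + k.*2.+1)%N by [].
  by rewrite expnD -mulnn; case: (q) q_gt0 => // q' _; nia.
exact: dvdn_mull.
Qed.

Section KummerAutomorphism.
Variables (q n : nat) (K : fieldType) (KF : Kn_field q n K).
Hypotheses (q_gt1 : (1 < q)%N) (qK : q%:R = 0 :> K) (m_gt0 : (0 < mexp q n)%N).

Local Notation m := (mexp q n).
Local Notation x := (Kn_x KF).
Local Notation y := (Kn_y KF).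
Local Notation z := (Kn_z KF).
Local Notation cst := (Kn_const KF).
Local Notation x_transc := (@Kn_x_transcendental _ _ _ KF).
Local Notation evx := (evalx cst x).
Local Notation evxz := (evalxz cst x).
Local Notation fracs w := (@fractions {poly {poly K}} KF (evxz w)).

(** As [q^2 - 1 = (q + 1)(q - 1)], this geometric sum is the quotient of [X^(q^2) - X] by
    [X^(q+1) - 1]; hence [z^m] is [y] times a polynomial in [x]. *)
Definition hpoly : {poly K} := 'X * \sum_(i < q.-1) 'X^(q + 1) ^+ i.

Lemma hpolyE : 'X^(q ^ 2) - 'X = ('X^(q + 1) - 1) * hpoly :> {poly K}.
Proof.
rewrite /hpoly mulrCA -subrX1 mulrBr mulr1 -exprM -exprS.
by congr ('X^_ - _); move: q_gt1; case: (q) => // q' _; rewrite -mulnn /=; lia.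
Qed.

(** Raising [z^m = y hpoly(x)] to the power [q + 1] eliminates [y] and leaves this polynomial in
    [x]. *)
Definition zpoly : {poly K} := ('X^(q + 1) - 1) * hpoly ^+ (q + 1).
Definition zpoly1 : {poly K} := (\sum_(i < q + 1) 'X ^+ i) * hpoly ^+ (q + 1).

Lemma zpolyE : zpoly = ('X - 1%:P) * zpoly1.
Proof. by rewrite /zpoly subrX1 -mulrA. Qed.

(** At 1 the first sum is [q + 1 = 1] and [hpoly] is [q - 1 = -1], because [q = 0] in [K]. So
    [zpoly] has a simple zero at 1. *)
Lemma zpoly1_root : ~~ root zpoly1 1.
Proof.
have sum1 k (P : {poly K}) : P.[1] = 1 -> (\sum_(i < k) P ^+ i).[1] = k%:R.
  move=> P1; rewrite horner_sum (eq_bigr (fun=> 1)) ?sumr_const ?card_ord //.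
  by move=> i _; rewrite horner_exp P1 expr1n.
rewrite /root hornerM horner_exp /hpoly hornerM hornerX mul1r !sum1; last 2 first.
- by rewrite hornerXn expr1n.
- by rewrite hornerX.
have -> : q.-1%:R = - 1 :> K.
  by apply/eqP; rewrite -addr_eq0 natr1 prednK ?qK // ltnW.
by rewrite natrD qK add0r mul1r signr_eq0.
Qed.

Lemma x_pow_sub1_neq0 : x ^+ (q + 1) - 1 != 0.
Proof.
have -> : x ^+ (q + 1) - 1 = evx ('X^(q + 1) - 1).
  by rewrite rmorphB rmorphXn /= evalxX rmorph1.
rewrite (evalx_eq0 x_transc) -size_poly_eq0 size_XnsubC ?addn1 //.
Qed.

Lemma hpoly_neq0 : hpoly != 0.
Proof.
apply: contraNneq zpoly1_root => h0.
by rewrite /zpoly1 h0 expr0n addn1 mulr0 root0.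
Qed.

Lemma evalx_hpoly_neq0 : evx hpoly != 0.
Proof. by rewrite (evalx_eq0 x_transc) hpoly_neq0. Qed.

Lemma z_exp_m : z ^+ m = y * evx hpoly.
Proof.
rewrite Kn_z_eq; congr (_ * _); apply: (canLR (mulfK x_pow_sub1_neq0)).
have := congr1 evx hpolyE.
by rewrite rmorphM /= !rmorphB !rmorphXn /= evalxX rmorph1 mulrC.
Qed.

Lemma z_exp_mq : z ^+ (m * (q + 1)) = evx zpoly.
Proof.
rewrite exprM z_exp_m exprMn Kn_y_eq /zpoly [in RHS]rmorphM rmorphB !rmorphXn /=.
by rewrite evalxX rmorph1.
Qed.

Lemma z_neq0 : z != 0.
Proof.
apply: (radical_neq0 (N' := (m * (q + 1)).-1) x_transc zpolyE zpoly1_root).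
by rewrite prednK ?z_exp_mq // muln_gt0 m_gt0 addn1.
Qed.

(** Among the generators only [y] needs a denominator: [y = w^m / hpoly(x)]. The lemma serves both
    [w = z] and [w = zeta z]. *)
Lemma evalxz_fractions (w u : KF) : w ^+ m = z ^+ m ->
  (exists P, evxz w P = z) -> fracs w u.
Proof.
move=> wm [Pz PzE].
suff : [set: KF] `<=` fracs w by apply.
rewrite -Kn_generated; apply: smallest_sub; first exact: fractions_subfield.
move=> _ [[a _ <-]|[[->|->]|->]].
- by rewrite -(evalxC cst x) -(evalxzC _ _ w); apply: fractions_image.
- by rewrite -[X in fracs _ X](evalxX cst x) -(evalxzC _ _ w); apply: fractions_image.
- exists ('X ^+ m), hpoly%:P; rewrite /= evalxzC evalx_hpoly_neq0 rmorphXn /=.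
  by rewrite evalxzX wm z_exp_m mulfK ?evalx_hpoly_neq0.
- by rewrite -PzE; apply: fractions_image.
Qed.

(** Evaluations at [z] and at [w = zeta z] have equal kernels, by [evalxz_ker] for [zeta] and for
    its inverse. The resulting automorphism fixes [y = z^m / hpoly(x)] since [w^m = z^m]. *)
Lemma kummer_automorphism (zeta : K) : zeta ^+ m = 1 ->
  exists s : KautKn KF, [/\ s x = x, s y = y & s z = cst zeta * z].
Proof.
move=> zetam.
have zeta0 : zeta != 0.
  by apply: contra_eq_neq zetam => ->; rewrite expr0n (gtn_eqF m_gt0) eq_sym oner_neq0.
pose w := cst zeta * z.
have wm : w ^+ m = z ^+ m by rewrite exprMn -rmorphXn zetam rmorph1 mul1r.
have N_gt0 : (0 < m * (q + 1))%N by rewrite muln_gt0 m_gt0 addn1.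
have zN : z ^+ (m * (q + 1)).-1.+1 = evx zpoly by rewrite prednK // z_exp_mq.
have wN : w ^+ (m * (q + 1)).-1.+1 = evx zpoly.
  by rewrite prednK // exprM wm -exprM z_exp_mq.
have ker a : evxz z a = 0 <-> evxz w a = 0.
  split; first apply: (evalxz_ker x_transc zpolyE zpoly1_root zN).
    by rewrite prednK // exprM -rmorphXn zetam rmorph1 expr1n.
  have -> : z = (cst zeta)^-1 * w by rewrite mulKf ?fmorph_eq0.
  apply: (evalxz_ker x_transc zpolyE zpoly1_root wN).
  by rewrite prednK // exprM exprVn -rmorphXn zetam rmorph1 invr1 expr1n.
have [||s [sB sM s_bij sE]] := fraction_automorphism ker.
- by move=> u; apply: evalxz_fractions => //; exists 'X; rewrite evalxzX.
- move=> u; apply: evalxz_fractions => //; exists ((zeta^-1)%:P%:P * 'X).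
  by rewrite rmorphM /= evalxzC evalxC evalxzX fmorphV mulKf ?fmorph_eq0.
have s_evx P : s (evx P) = evx P by rewrite -{1}(evalxzC _ _ z) sE /= evalxzC.
have s_fix : `[< is_fixaut (@Kconst q n K KF) s >].
  apply/asboolP; split=> // _ [a _ <-].
  by rewrite -(evalxC cst x) s_evx.
exists (FixAut s_fix); split=> /=.
- by rewrite -{1}(evalxX cst x) s_evx evalxX.
- have [s1 smul] := sM.
  apply: (mulIf evalx_hpoly_neq0); rewrite -{1}s_evx -smul -z_exp_m.
  rewrite -[in LHS](evalxzX cst x z) -rmorphXn sE rmorphXn /= evalxzX.
  by rewrite wm.
- by rewrite -{1}(evalxzX cst x z) sE /= evalxzX.
Qed.

End KummerAutomorphism.

(** * The group Aut(Kn) *)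

Section FixautMorphism.
Variables (E : fieldType) (B : set E) (s : fixaut B).

Let s_zmod : zmod_morphism s. Proof. by case: (fixautP s). Qed.
Let s_monoid : monoid_morphism s. Proof. by case: (fixautP s). Qed.

HB.instance Definition _ := GRing.isZmodMorphism.Build E E s s_zmod.
HB.instance Definition _ := GRing.isMonoidMorphism.Build E E s s_monoid.

Lemma fixaut_fix (u : E) : B u -> s u = u.
Proof. by case: (fixautP s) => _ _ _; apply. Qed.

End FixautMorphism.

Lemma fixautM (E : fieldType) (B : set E) (s t : fixaut B) (u : E) :
  (s * t)%g u = s (t u).
Proof. by []. Qed.

Lemma fixaut1 (E : fieldType) (B : set E) (u : E) : (1%g : fixaut B) u = u.
Proof. by []. Qed.

Lemma fixautV (E : fieldType) (B : set E) (s : fixaut B) (u v : E) :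
  s u = v -> (s^-1)%g v = u.
Proof. by move=> <-; exact: fixautK. Qed.

Section Alpha.
Variables (q n : nat) (F : finFieldType) (K : fieldType).
Variables (j : {rmorphism F -> K}) (KF : Kn_field q n K).
Hypotheses (q_gt1 : (1 < q)%N) (n_odd : odd n) (q_char : [pchar F].-nat q).

Local Notation m := (mexp q n).
Local Notation x := (Kn_x KF).
Local Notation y := (Kn_y KF).
Local Notation z := (Kn_z KF).
Local Notation cst := (Fconst j KF).

HB.instance Definition _ := GRing.RMorphism.copy cst (Kn_const KF \o j).

Lemma fixaut_Fconst (s : KautKn KF) (a : F) : s (cst a) = cst a.
Proof. by apply: fixaut_fix; exists (j a). Qed.

Lemma natr_q_eq0 : q%:R = 0 :> K.
Proof.
have /(_ _ (pdiv_prime q_gt1) (pdiv_dvd q)) := elimT (pnatP _ (ltnW q_gt1)) q_char.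
move=> pF; rewrite -(rmorph_nat j); apply/eqP; rewrite fmorph_eq0 -(dvdn_pcharf pF).
exact: pdiv_dvd.
Qed.

Lemma mexp_mulS : (m * (q + 1) = q ^ n + 1)%N.
Proof. by rewrite mexpM // ltnW. Qed.

Lemma mexp_gt0 : (0 < m)%N.
Proof. by move: (addn1 (q ^ n)); rewrite -mexp_mulS; case: (mexp q n). Qed.

Lemma muE (k : nat) (u : {unit F}) : mu k u <-> val u ^+ k = 1.
Proof.
split; first by move=> uk; rewrite -val_unitX uk val_unit1.
by move=> uk; apply: val_inj; rewrite /= val_unitX uk.
Qed.

Lemma mu_dvdn (k l : nat) (u : {unit F}) : (k %| l)%N -> mu k u -> mu l u.
Proof.
by move=> /dvdnP[i ->] /muE uk; apply/muE; rewrite mulnC exprM uk expr1n.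
Qed.

Lemma mu1 (k : nat) : mu k (1%g : {unit F}).
Proof. by apply/muE; rewrite val_unit1 expr1n. Qed.

Lemma mu_subgroup (k : nat) : subgroup (@mu F k).
Proof.
split; first by apply/mem_set/mu1.
move=> u v /set_mem/muE uk /set_mem/muE vk; apply/mem_set/muE.
by rewrite val_unitM val_unitV exprMn exprVn uk vk invr1 mulr1.
Qed.

Definition tau (xi : {unit F}) : F := val xi ^+ m.

Lemma tau_exp (xi : {unit F}) : mu (q ^ n + 1) xi -> tau xi ^+ q * tau xi = 1.
Proof. by move=> /muE; rewrite -mexp_mulS exprM addn1 exprSr. Qed.

Lemma tau_neq0 (xi : {unit F}) : tau xi != 0.
Proof. by rewrite expf_neq0 // -unitfE (valP xi). Qed.

Lemma frobD (a b : F) : (a + b) ^+ q = a ^+ q + b ^+ q.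
Proof. exact: exprDn_pchar. Qed.

Lemma frobN (a : F) : (- a) ^+ q = - a ^+ q.
Proof.
apply/eqP; rewrite -addr_eq0 -frobD addNr expr0n.
by rewrite (gtn_eqF (ltnW q_gt1)).
Qed.

(** In this form [a ^+ q] can act as an atom, the conjugate of [a], and the composition laws become
    identities for [ring] and [field]. *)
Lemma ac_paramP (a c : F) : ac_param q a c <->
  [/\ (a ^+ q) ^+ q = a, (c ^+ q) ^+ q = c & a ^+ q * a - c ^+ q * c = 1].
Proof. by rewrite /ac_param !addn1 !exprSr -!exprM. Qed.

Lemma ac_param_mul (a c a' c' t : F) :
    ac_param q a c -> ac_param q a' c' -> t ^+ q * t = 1 ->
  ac_param q (a * a' + c * c' ^+ q * t) (a * c' + c * a' ^+ q * t).
Proof.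
move=> /ac_paramP[aq cq ac] /ac_paramP[aq' cq' ac'] tq.
have t0 : t != 0 by apply: contra_eq_neq tq => ->; rewrite mulr0 eq_sym oner_neq0.
have tqE : t ^+ q = t^-1 by apply: (mulIf t0); rewrite tq mulVf.
have tqq : (t ^+ q) ^+ q = t by rewrite tqE exprVn tqE invrK.
apply/ac_paramP; rewrite !(frobD, exprMn) aq cq aq' cq' tqq; split=> //.
set A := a ^+ q in ac *; set C := c ^+ q in ac *.
set A' := a' ^+ q in ac' *; set C' := c' ^+ q in ac' *.
(* Multiplicativity of the Hermitian norm: the mixed terms cancel. *)
transitivity ((A * a - t ^+ q * t * (C * c)) * (A' * a' - C' * c')); first by ring.
by rewrite tq ac' mul1r mulr1.
Qed.

Lemma ac_param_inv (a c t : F) : ac_param q a c -> t ^+ q * t = 1 ->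
  ac_param q (a ^+ q) (- (c / t)).
Proof.
move=> /ac_paramP[aq cq ac] tq.
have t0 : t != 0 by apply: contra_eq_neq tq => ->; rewrite mulr0 eq_sym oner_neq0.
have tqE : t ^+ q = t^-1 by apply: (mulIf t0); rewrite tq mulVf.
have tqq : (t ^+ q) ^+ q = t by rewrite tqE exprVn tqE invrK.
apply/ac_paramP; rewrite !(frobN, exprMn, exprVn) aq cq tqq; split=> //.
by rewrite tqE invrK -[RHS]ac; field.
Qed.

Lemma ac_param1 : ac_param q (1 : F) 0.
Proof.
apply/ac_paramP; rewrite !expr1n expr0n (gtn_eqF (ltnW q_gt1)).
by rewrite expr0n (gtn_eqF (ltnW q_gt1)) mulr0 subr0 mulr1.
Qed.

Lemma fixaut_lin (s : KautKn KF) (a b : F) (u v : KF) :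
  s (cst a * u + cst b * v) = cst a * s u + cst b * s v.
Proof. by rewrite rmorphD !rmorphM /= !fixaut_Fconst. Qed.

(** Linear substitutions are composed; the identity [tau xi' ^+ q * tau xi' = 1] brings the
    coefficients of [y] back to the form that [is_alpha] demands. *)
Lemma is_alpha_mul (a c a' c' : F) (xi xi' : {unit F}) (s s' : KautKn KF) :
    ac_param q a' c' -> mu (q ^ n + 1) xi' ->
    is_alpha j a c xi s -> is_alpha j a' c' xi' s' ->
  is_alpha j (a * a' + c * c' ^+ q * tau xi') (a * c' + c * a' ^+ q * tau xi')
    (xi * xi')%g (s * s')%g.
Proof.
move=> /ac_paramP[aq' cq' _] /tau_exp tq [sx sy sz] [sx' sy' sz'].
have tauM : tau (xi * xi')%g = tau xi * tau xi' by rewrite /tau val_unitM exprMn.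
rewrite -/(tau xi) in sx sy; rewrite -/(tau xi') in sx' sy'.
rewrite /is_alpha -/(tau (xi * xi')%g) tauM val_unitM.
split.
- rewrite fixautM sx' fixaut_lin sx sy !mulrDr !mulrA -!rmorphM addrACA -!mulrDl.
  rewrite -!rmorphD; congr (cst _ * _ + cst _ * _); first by ring.
  rewrite frobD !exprMn aq'.
  transitivity (a ^+ q * c' ^+ q * tau xi * tau xi' +
    c ^+ q * a' * tau xi * (tau xi' ^+ q * tau xi')); last by ring.
  by rewrite tq; ring.
- rewrite fixautM sy' fixaut_lin sx sy !mulrDr !mulrA -!rmorphM addrACA -!mulrDl.
  rewrite -!rmorphD; congr (cst _ * _ + cst _ * _); first by ring.
  rewrite frobD !exprMn cq'.
  transitivity (a ^+ q * a' ^+ q * tau xi * tau xi' +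
    c ^+ q * c' * tau xi * (tau xi' ^+ q * tau xi')); last by ring.
  by rewrite tq; ring.
- by rewrite fixautM sz' rmorphM /= fixaut_Fconst sz rmorphM mulrCA mulrA.
Qed.

(** On the span of [x] and [y] the determinant is [tau xi * (a^(q+1) - c^(q+1)) = tau xi], whence
    the denominators in the inverse matrix. *)
Lemma is_alpha_inv (a c : F) (xi : {unit F}) (s : KautKn KF) :
    ac_param q a c -> mu (q ^ n + 1) xi -> is_alpha j a c xi s ->
  is_alpha j (a ^+ q) (- (c / tau xi)) xi^-1%g s^-1%g.
Proof.
move=> /ac_paramP[aq cq ac] /tau_exp tq [sx sy sz].
have t0 := tau_neq0 xi.
have tqE : tau xi ^+ q = (tau xi)^-1 by apply: (mulIf t0); rewrite tq mulVf.
rewrite /is_alpha val_unitV exprVn -/(tau xi) in sx sy *.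
rewrite frobN exprMn exprVn tqE invrK aq.
split; apply: fixautV.
- rewrite fixaut_lin sx sy !mulrDr !mulrA -!rmorphM addrACA -!mulrDl -!rmorphD.
  transitivity (cst 1 * x + cst 0 * y); last first.
    by rewrite rmorph1 rmorph0 mul1r mul0r addr0.
  by congr (cst _ * _ + cst _ * _); rewrite -?[1 in RHS]ac; field.
- rewrite fixaut_lin sx sy !mulrDr !mulrA -!rmorphM addrACA -!mulrDl -!rmorphD.
  transitivity (cst 0 * x + cst 1 * y); last first.
    by rewrite rmorph1 rmorph0 mul1r mul0r add0r.
  by congr (cst _ * _ + cst _ * _); rewrite -?[1 in RHS]ac; field.
- rewrite rmorphM /= fixaut_Fconst sz mulrA -rmorphM mulVf ?rmorph1 ?mul1r //.
  by rewrite -unitfE (valP xi).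
Qed.

(** The set [U] of values of [xi] is left free: all of [mu (q ^ n + 1)] gives [AutKn], while [mu m]
    bounds [SlCm]. *)
Definition alphas (U : set {unit F}) : set (KautKn KF) :=
  [set s | exists a c xi, [/\ ac_param q a c, U xi & is_alpha j a c xi s]].

Lemma alphas_subgroup (U : set {unit F}) :
  subgroup U -> U `<=` mu (q ^ n + 1) -> subgroup (alphas U).
Proof.
move=> [/set_mem U1 UV] U_mu; split.
  apply/mem_set; exists 1, 0, 1%g; split=> //; first exact: ac_param1.
  rewrite /is_alpha val_unit1 !expr1n expr0n (gtn_eqF (ltnW q_gt1)) mul0r mul1r.
  by rewrite rmorph1 rmorph0 !mul0r !mul1r addr0 add0r.
move=> s t /set_mem[a [c [xi [ac Uxi sE]]]] /set_mem[a' [c' [xi' [ac' Uxi' tE]]]].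
have tV := is_alpha_inv ac' (U_mu _ Uxi') tE.
have acV := ac_param_inv ac' (tau_exp (U_mu _ Uxi')).
have UVxi' : U xi'^-1%g.
  by rewrite -[X in U X]mul1g; apply/set_mem/UV; apply/mem_set.
apply/mem_set; do 3!eexists; split; last 1 first.
- exact: is_alpha_mul acV (U_mu _ UVxi') sE tV.
- by apply: ac_param_mul => //; apply/tau_exp/U_mu.
- by apply/set_mem/UV; apply/mem_set.
Qed.

Lemma AutKn_subgroup : subgroup (AutKn j KF).
Proof. by apply: (@alphas_subgroup (mu (q ^ n + 1))) => //; apply: mu_subgroup. Qed.

End Alpha.

Lemma subgroup1 (G : groupType) (A : set G) : subgroup A -> A 1%g.
Proof. by case=> /set_mem. Qed.

Lemma subgroup_div (G : groupType) (A : set G) (u v : G) :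
  subgroup A -> A u -> A v -> A (u * v^-1)%g.
Proof. by case=> _ AV Au Av; apply/set_mem/AV; apply/mem_set. Qed.

Lemma subgroupV (G : groupType) (A : set G) (u : G) :
  subgroup A -> A u -> A u^-1%g.
Proof.
by move=> A_sub Au; rewrite -[X in A X]mul1g; apply: subgroup_div (subgroup1 _) _.
Qed.

Lemma subgroupM (G : groupType) (A : set G) (u v : G) :
  subgroup A -> A u -> A v -> A (u * v)%g.
Proof.
move=> A_sub Au Av; rewrite -[v]invgK; apply: subgroup_div => //.
exact: subgroupV.
Qed.

(** * Restriction to H and the maps pi, rho and rhobar *)

Section Restriction.
Variables (q n : nat) (F : finFieldType) (K : fieldType).
Variables (j : {rmorphism F -> K}) (KF : Kn_field q n K).
Hypotheses (q_gt1 : (1 < q)%N) (n_odd : odd n) (q_char : [pchar F].-nat q).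

Local Notation m := (mexp q n).
Local Notation x := (Kn_x KF).
Local Notation y := (Kn_y KF).
Local Notation z := (Kn_z KF).
Local Notation cst := (Fconst j KF).
Local Notation H := (gen_subfield (@Kconst q n K KF `|` [set x; y])).

Let qK := natr_q_eq0 j q_gt1 q_char.
Let m_gt0 := mexp_gt0 q_gt1 n_odd.
Let Aut_sub := AutKn_subgroup j KF q_gt1 n_odd q_char.

Lemma AutKn_gen_subfield (s : KautKn KF) (u : KF) :
  AutKn j KF s -> u \in H -> s u \in H.
Proof.
move=> [a [c [xi [_ _ [sx sy _]]]]] /set_mem uH.
suff : H `<=` [set v | s v \in H] by apply.
apply: smallest_sub.
  have [H1 HB HV] := @gen_subfield_closed KF (@Kconst q n K KF `|` [set x; y]).
  split; first by apply/mem_set; rewrite /= rmorph1.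
    by move=> v w /set_mem vH /set_mem wH; apply/mem_set; rewrite /= rmorphB; apply: HB.
  by move=> v w /set_mem vH /set_mem wH; apply/mem_set; rewrite /= fmorph_div; apply: HV.
(* Membership comes for free from computing the same expression inside [HF]. *)
have lin b d : cst b * x + cst d * y \in H.
  exact: valP (FconstH j KF b * xH KF + FconstH j KF d * yH KF).
move=> _ [[a' _ <-]|[->|->]] /=; last 2 first.
- by rewrite sx.
- by rewrite sy.
rewrite fixaut_fix; last by exists a'.
by apply/mem_set; apply: sub_gen_smallest; left; exists a'.
Qed.

(** Shows that the default value in [piH] is never taken on [AutKn]: both [s] and its inverse
    preserve [H], so the restriction is bijective. *)
Lemma piHE (s : KautKn KF) (u : HF KF) :
  AutKn j KF s -> val (piH s u) = s (val u).
Proof.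
move=> sA.
have sVA : AutKn j KF s^-1%g by apply: subgroupV.
pose f (v : HF KF) : HF KF := GenField (AutKn_gen_subfield sA (valP v)).
pose g (v : HF KF) : HF KF := GenField (AutKn_gen_subfield sVA (valP v)).
have f_aut : `[< is_fixaut [set v : HF KF | Kconst (val v)] f >].
  apply/asboolP; split.
  - by move=> v w; apply: val_inj; rewrite /= rmorphB.
  - by split=> [|v w]; apply: val_inj; rewrite /= ?rmorph1 ?rmorphM.
  - exists g => v; apply: val_inj => /=; first by apply: fixautV.
    by have := fixautM s s^-1%g (val v); rewrite mulgV.
  - by move=> v Kv; apply: val_inj; rewrite /= fixaut_fix.
suff : [set b : KautH KF | forall v : HF KF, val (b v) = s (val v)] (piH s) by apply.
by apply: xgetPex; exists (FixAut f_aut).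
Qed.

Lemma piHM (s t : KautKn KF) :
  AutKn j KF s -> AutKn j KF t -> piH (s * t)%g = (piH s * piH t)%g.
Proof.
move=> sA tA; apply: fixaut_eqP => u; apply: val_inj.
by rewrite piHE ?fixautM ?piHE //; apply: subgroupM.
Qed.

Lemma piHV (s : KautKn KF) : AutKn j KF s -> piH s^-1%g = (piH s)^-1%g.
Proof.
move=> sA; have sVA := subgroupV Aut_sub sA.
apply: (mulgI (piH s)); rewrite -piHM // !mulgV.
apply: fixaut_eqP => u; apply: val_inj.
by rewrite piHE //; exact: subgroup1.
Qed.

Lemma piH_eq1P (s : KautKn KF) : AutKn j KF s ->
  (piH s = 1%g <-> s x = x /\ s y = y).
Proof.
move=> sA; split=> [s1|[sx sy]].
  have fixH (u : HF KF) : s (val u) = val u by rewrite -piHE // s1.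
  by split; [apply: (fixH (xH KF)) | apply: (fixH (yH KF))].
apply: fixaut_eqP => u; apply: val_inj; rewrite piHE //=.
suff : H `<=` [set v | s v = v] by apply; apply: set_mem; apply: valP.
apply: smallest_sub; last first.
  by move=> _ [[a' _ <-]|[->|->]] //=; rewrite fixaut_fix //; exists a'.
split; first by apply/mem_set; rewrite /= rmorph1.
  by move=> v w /set_mem vH /set_mem wH; apply/mem_set; rewrite /= rmorphB /= vH wH.
by move=> v w /set_mem vH /set_mem wH; apply/mem_set; rewrite /= fmorph_div /= vH wH.
Qed.

Lemma cst_mul_z_inj (u v : {unit F}) : cst (val u) * z = cst (val v) * z -> u = v.
Proof.
by move/(mulIf (z_neq0 KF q_gt1 qK m_gt0))/fmorph_inj/val_inj.
Qed.

(** Since [z] is nonzero, [s z] determines [xi], whichever parameters the choice operator picks. *)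
Lemma rho_alpha (a c : F) (xi : {unit F}) (s : KautKn KF) :
    ac_param q a c -> mu (q ^ n + 1) xi -> is_alpha j a c xi s ->
  rho j s = xi.
Proof.
move=> ac mu_xi sE; rewrite /rho.
have /(xgetPex 1%g)[a' [c' [_ _ [_ _ sz']]]] : exists u : {unit F}, exists a c,
  [/\ ac_param q a c, mu (q ^ n + 1) u & is_alpha j a c u s] by exists xi, a, c.
by apply: cst_mul_z_inj; rewrite -sz'; case: sE.
Qed.

Lemma rhoE (s : KautKn KF) (xi : {unit F}) :
  AutKn j KF s -> rho j s = xi <-> s z = cst (val xi) * z.
Proof.
move=> [a [c [xi' [ac mu_xi sE]]]]; rewrite (rho_alpha ac mu_xi sE).
have [_ _ sz] := sE; rewrite sz.
by split=> [->|/cst_mul_z_inj].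
Qed.

Lemma rho_z (s : KautKn KF) : AutKn j KF s -> s z = cst (val (rho j s)) * z.
Proof. by move=> sA; apply/rhoE. Qed.

Lemma rhoM (s t : KautKn KF) :
  AutKn j KF s -> AutKn j KF t -> rho j (s * t)%g = (rho j s * rho j t)%g.
Proof.
move=> sA tA; apply/rhoE; first exact: subgroupM.
rewrite val_unitM fixautM (rho_z tA) rmorphM /= fixaut_Fconst (rho_z sA).
by rewrite rmorphM mulrCA mulrA.
Qed.

Lemma rhoV (s : KautKn KF) : AutKn j KF s -> rho j s^-1%g = (rho j s)^-1%g.
Proof.
move=> sA; have sVA := subgroupV Aut_sub sA.
apply: (mulgI (rho j s)); rewrite -rhoM // !mulgV.
apply/rhoE; first exact: subgroup1.
by rewrite fixaut1 val_unit1 rmorph1 mul1r.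
Qed.

Lemma mexp_dvd : (m %| q ^ n + 1)%N.
Proof. by rewrite -(mexp_mulS q_gt1 n_odd) dvdn_mulr. Qed.

Lemma is_alpha10P (xi : {unit F}) (s : KautKn KF) : mu m xi ->
  (is_alpha j 1 0 xi s <-> [/\ s x = x, s y = y & s z = cst (val xi) * z]).
Proof.
move/muE => xim; rewrite /is_alpha xim expr1n expr0n (gtn_eqF (ltnW q_gt1)).
by rewrite !(mul0r, mul1r, rmorph0, rmorph1, addr0, add0r).
Qed.

Lemma alpha10_exists (xi : {unit F}) : mu m xi ->
  exists s : KautKn KF, is_alpha j 1 0 xi s.
Proof.
move=> mu_xi; have [|s sE] := @kummer_automorphism _ _ _ KF q_gt1 qK m_gt0 (j (val xi)).
  by rewrite -rmorphXn (muE m xi).1 // rmorph1.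
by exists s; apply/is_alpha10P.
Qed.

Lemma alpha10_AutKn (xi : {unit F}) (s : KautKn KF) : mu m xi ->
  is_alpha j 1 0 xi s -> AutKn j KF s.
Proof.
move=> mu_xi sE; exists 1, 0, xi; split=> //; first exact: ac_param1.
exact: mu_dvdn mexp_dvd mu_xi.
Qed.

Lemma alpha10_Cm (xi : {unit F}) (s : KautKn KF) : mu m xi ->
  is_alpha j 1 0 xi s -> Cm j KF s.
Proof.
move=> mu_xi sE; have sA := alpha10_AutKn mu_xi sE; split=> //.
by apply/(piH_eq1P sA); have [sx sy _] := (is_alpha10P s mu_xi).1 sE.
Qed.

(* [z ^ m] lies in [H], so an automorphism trivial on [H] multiplies [z] by an
   [m]-th root of unity. *)
Lemma Cm_alpha10 (s : KautKn KF) :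
  Cm j KF s -> mu m (rho j s) /\ is_alpha j 1 0 (rho j s) s.
Proof.
move=> [sA /(piH_eq1P sA)[sx sy]].
suff mu_s : mu m (rho j s).
  by split=> //; apply/is_alpha10P => //; split=> //; apply: rho_z.
have zm0 : z ^+ m != 0 by rewrite expf_neq0 // (z_neq0 KF q_gt1 qK m_gt0).
apply/muE; apply: (fmorph_inj cst); apply: (mulIf zm0).
rewrite rmorph1 mul1r rmorphXn -exprMn -rho_z // -rmorphXn /= Kn_z_eq.
by rewrite rmorphM fmorph_div !rmorphB !rmorphXn rmorph1 /= sx sy.
Qed.

(** Elements of [Sl] have [xi = 1] and those of [Cm] have [xi] in [mu m], so the subgroup they
    generate stays in [alphas (mu m)]. *)
Lemma SlCm_alphas (s : KautKn KF) : SlCm j KF s -> @alphas q n F K j KF (mu m) s.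
Proof.
suff : SlCm j KF `<=` @alphas q n F K j KF (mu m) by apply.
apply: smallest_sub.
  apply: alphas_subgroup => //; first exact: mu_subgroup.
  by move=> u; apply: mu_dvdn mexp_dvd.
move=> t [[a [c [ac tE]]]|/Cm_alpha10[mu_t tE]].
  by exists a, c, 1%g; split=> //; apply: mu1.
by exists 1, 0, (rho j t); split=> //; apply: ac_param1.
Qed.

Lemma SlCm_AutKn : SlCm j KF `<=` AutKn j KF.
Proof.
move=> s /SlCm_alphas[a [c [xi [ac mu_xi sE]]]]; exists a, c, xi; split=> //.
exact: mu_dvdn mexp_dvd mu_xi.
Qed.

Lemma SlCm_rho (s : KautKn KF) : SlCm j KF s -> mu m (rho j s).
Proof.
move=> /SlCm_alphas[a [c [xi [ac mu_xi sE]]]]; rewrite (rho_alpha ac _ sE) //.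
exact: mu_dvdn mexp_dvd mu_xi.
Qed.

(** Dividing [s] by [alpha_{1,0,xi}] with [xi = rho s] makes [rho] trivial, which puts the quotient
    in [Sl], and leaves [piH] unchanged. *)
Lemma SlCm_piH (s : KautKn KF) : SlCm j KF s -> (piH @` Sl j KF) (piH s).
Proof.
move=> sSC; have sA := SlCm_AutKn sSC; have mu_s := SlCm_rho sSC.
have [t tE] := alpha10_exists mu_s.
have tA := alpha10_AutKn mu_s tE; have tVA := subgroupV Aut_sub tA.
have [_ t1] := alpha10_Cm mu_s tE.
exists (s * t^-1)%g; last by rewrite piHM // piHV // t1 invg1 mulg1.
have [a [c [xi [ac mu_xi stE]]]] := subgroup_div Aut_sub sA tA.
exists a, c; split=> //; suff <- : xi = 1%g by [].
rewrite -(rho_alpha ac mu_xi stE) rhoM // rhoV //.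
have [_ _ tz] := tE; have -> : rho j t = rho j s by apply/rhoE.
exact: mulgV.
Qed.

(** If [y = b x], then [(1 - b^(q+1)) x^(q+1) - 1 = 0]. This polynomial is nonzero for every [b],
    having constant term -1, so [x] would be algebraic. *)
Lemma Fconst_xy_free (a c : F) : cst a * x + cst c * y = 0 -> a = 0 /\ c = 0.
Proof.
have x0 : x != 0.
  apply/eqP => x0; case: (@Kn_x_transcendental _ _ _ KF).
  by exists 'X; rewrite ?polyX_eq0 // map_polyX x0 rootX.
move=> ac0; have [c0|c0] := eqVneq c 0.
  move/eqP: ac0; rewrite c0 rmorph0 mul0r addr0 mulf_eq0 (negPf x0) orbF.
  by rewrite fmorph_eq0 => /eqP.
have yE : y = cst (- (a / c)) * x.
  apply: (mulfI (_ : cst c != 0)); first by rewrite fmorph_eq0.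
  rewrite mulrA -rmorphM mulrN mulrCA mulfV // mulr1 rmorphN mulNr.
  by apply/eqP; rewrite -addr_eq0 addrC ac0.
set b := - (a / c) in yE; exfalso.
case: (@Kn_x_transcendental _ _ _ KF).
exists ((1 - j b ^+ (q + 1))%:P * 'X^(q + 1) - 1).
  apply/eqP => /(congr1 (horner^~ 0)); rewrite hornerD hornerM hornerN !hornerE.
  by rewrite expr0n addn1 mulr0 sub0r => /eqP; rewrite oppr_eq0 oner_eq0.
rewrite rmorphB rmorphM /= map_polyC map_polyXn rmorph1 /root !hornerE.
have := @Kn_y_eq _ _ _ KF; rewrite yE exprMn /= => yx.
rewrite /= rmorphB rmorph1 rmorphXn mulrBl mul1r addrAC -yx subr_eq0; apply/eqP.
by [].
Qed.

Lemma is_beta_piH (a c : F) (xi : {unit F}) (s : KautKn KF) : AutKn j KF s ->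
  is_alpha j a c xi s -> is_beta j a c (xi ^+ m)%g (piH s).
Proof.
by move=> sA [sx sy _]; split; apply: val_inj; rewrite piHE // val_unitX.
Qed.

Lemma is_beta_unique (a c a' c' : F) (t t' : {unit F}) (b : KautH KF) :
  ac_param q a c -> is_beta j a c t b -> is_beta j a' c' t' b -> t = t'.
Proof.
move=> /ac_paramP[_ _ ac] [bx by_] [bx' by'].
have free (d e d' e' : F) : cst d * x + cst e * y = cst d' * x + cst e' * y ->
    d = d' /\ e = e'.
  move/eqP; rewrite -subr_eq0 opprD addrACA -!mulrBl -!rmorphB => /eqP.
  by move/Fconst_xy_free => [/subr0_eq-> /subr0_eq->].
have [aE ctE] := free _ _ _ _ (congr1 val (etrans (esym bx) bx')).
have [cE atE] := free _ _ _ _ (congr1 val (etrans (esym by_) by')).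
rewrite -aE -cE in ctE atE; apply: val_inj.
(* Either of [a] and [c] may vanish, so neither is cancelled: [t] and [t'] are multiplied by
   [1 = a^q a - c^q c] instead. *)
rewrite -[LHS]mul1r -[RHS]mul1r -ac !mulrBl ![_ * a * _]mulrAC ![_ * c * _]mulrAC.
by rewrite atE ctE.
Qed.

(** [is_beta_piH] provides a value for the choice in [rhobar], and [is_beta_unique] shows that there
    is no other. *)
Lemma rhobar_piH (s : KautKn KF) :
  AutKn j KF s -> rhobar j (piH s) = (rho j s ^+ m)%g.
Proof.
move=> sA; have [a [c [xi [ac mu_xi sE]]]] := sA.
rewrite (rho_alpha ac mu_xi sE) /rhobar.
have bE := is_beta_piH sA sE.
have mu_xim : mu (q + 1) (xi ^+ m)%g.
  by apply/muE; rewrite val_unitX -exprM (mexp_mulS q_gt1 n_odd) (muE _ _).1.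
have /(xgetPex 1%g)[a' [c' [_ _ bE']]] : exists u : {unit F}, exists a c,
  [/\ ac_param q a c, mu (q + 1) u & is_beta j a c u (piH s)].
  by exists (xi ^+ m)%g, a, c.
by apply/esym/(is_beta_unique ac bE bE').
Qed.

End Restriction.

(** * Construction of the subgroup L *)

Theorem theorem2p5 (p h n q : nat) (F : finFieldType) (K : closedFieldType)
    (j : {rmorphism F -> K}) (KF : Kn_field q n K)
    (L0 : set {unit F}) (L1 : set (KautKn KF)) (Lbar : set (KautH KF)) :
  prime p -> (1 <= h)%N -> q = (p ^ h)%N -> (1 <= n)%N -> odd n ->
  #|F| = (q ^ (2 * n))%N ->
  (forall u : K, algebraicOver j u) ->
  subgroup L0 -> L0 `<=` mu (q ^ n + 1) ->
  subgroup L1 -> L1 `<=` SlCm j KF ->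
  subgroup Lbar -> Lbar `<=` Ml j KF ->
  rhobar j @` Lbar = [set (xi ^+ mexp q n)%g | xi in L0] ->
  Lbar `&` piH @` Sl j KF = piH @` L1 ->
  rho j @` L1 = L0 `&` mu (mexp q n) ->
  L1 `&` Cm j KF =
    [set s | exists2 xi, (L0 `&` mu (mexp q n)) xi & is_alpha j 1 0 xi s] ->
  exists L : set (KautKn KF),
    [/\ subgroup L, L `<=` AutKn j KF, rho j @` L = L0,
        L `&` SlCm j KF = L1 & piH @` L = Lbar].
Proof.
move=> p_pr h_gt0 qE _ n_odd cardF _ L0_sub L0_mu L1_sub L1_SlCm Lbar_sub Lbar_Ml.
move=> rhobar_Lbar Lbar_Sl rho_L1 L1_Cm.
have q_gt1 : (1 < q)%N by rewrite qE -(exp1n h) ltn_exp2r // prime_gt1.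
have q_char : [pchar F].-nat q.
  rewrite qE pnatX; apply/orP; left; rewrite pnatE //.
  by apply: (@card_finPcharP F p (h * (2 * n))) => //; rewrite expnM -qE.
have Aut_sub := AutKn_subgroup j KF q_gt1 n_odd q_char.
have Aut_SlCm : SlCm j KF `<=` AutKn j KF := SlCm_AutKn q_gt1 n_odd q_char.
pose L := [set s | [/\ AutKn j KF s, L0 (rho j s) & Lbar (piH s)]].
have L_sub : subgroup L.
  have A1 : AutKn j KF 1%g by exact: subgroup1.
  split=> [|s t /set_mem[sA L0s Ls] /set_mem[tA L0t Lt]]; apply/mem_set; split=> //.
  - suff -> : rho j (1%g : KautKn KF) = 1%g by exact: subgroup1.
    by apply/rhoE => //; rewrite fixaut1 val_unit1 rmorph1 mul1r.
  - suff -> : piH (1%g : KautKn KF) = 1%g by exact: subgroup1.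
    exact/(piH_eq1P q_gt1 n_odd q_char A1).
  - exact: subgroup_div.
  - rewrite (rhoM q_gt1 n_odd q_char sA) ?rhoV //; last exact: subgroupV.
    exact: subgroup_div.
  - rewrite (piHM q_gt1 n_odd q_char sA) ?(piHV q_gt1 n_odd q_char tA) //.
      exact: subgroup_div.
    exact: subgroupV.
(* Every compatible pair of [b] and [xi] is attained by one element of [L]; this yields both
   [rho(L) = L0] and [pi(L) = Lbar]. *)
have L_lift (b : KautH KF) (xi : {unit F}) : Lbar b -> L0 xi ->
    rhobar j b = (xi ^+ mexp q n)%g -> exists2 s, L s & rho j s = xi /\ piH s = b.
  move=> Lb L0xi bxi; have [s sA sb] := Lbar_Ml b Lb.
  rewrite -sb rhobar_piH // in bxi.
  (* Both [rho s] and [xi] have [m]-th power [rhobar b]. *)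
  have mu_d : mu (mexp q n) ((rho j s)^-1 * xi)%g.
    apply/muE; rewrite val_unitM val_unitV exprMn exprVn -!val_unitX bxi.
    by rewrite mulVf // -unitfE; apply: valP.
  have [t tE] := alpha10_exists j KF q_gt1 n_odd q_char mu_d.
  have [tA t1] := alpha10_Cm q_gt1 n_odd q_char mu_d tE.
  have rho_st : rho j (s * t)%g = xi.
    have [_ _ tz] := tE.
    have -> : rho j (s * t)%g = (rho j s * rho j t)%g by apply: rhoM.
    have -> : rho j t = ((rho j s)^-1 * xi)%g by apply/rhoE.
    exact: mulKVg.
  have pi_st : piH (s * t)%g = b by rewrite (piHM q_gt1 n_odd q_char sA tA) t1 mulg1.
  by exists (s * t)%g => //; split; rewrite ?rho_st ?pi_st //; apply: subgroupM.
exists L; split=> //.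
- by move=> s [].
- apply/seteqP; split=> [_ [s [_ ? _] <-] //|xi L0xi].
  (* Here [L0^m] must lie in the image of [Lbar]; the equality [pi(L) = Lbar] uses the other
     inclusion. *)
  have [b Lb bxi] : (rhobar j @` Lbar) (xi ^+ mexp q n)%g.
    by rewrite rhobar_Lbar; exists xi.
  by have [s Ls [sxi _]] := L_lift b xi Lb L0xi bxi; exists s.
- apply/seteqP; split=> s.
    move=> [[sA L0s Ls] sSC].
    have [t L1t ts] : (piH @` L1) (piH s).
      by rewrite -Lbar_Sl; split=> //; apply: SlCm_piH.
    have tSC := L1_SlCm _ L1t; have tA := Aut_SlCm _ tSC.
    have [L0t mu_t] : (L0 `&` mu (mexp q n)) (rho j t) by rewrite -rho_L1; exists t.
    have dA : AutKn j KF (t^-1 * s)%g by apply: subgroupM => //; apply: subgroupV.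
    have dC : Cm j KF (t^-1 * s)%g.
      split=> //; rewrite (piHM q_gt1 n_odd q_char _ sA); last exact: subgroupV.
      by rewrite (piHV q_gt1 n_odd q_char tA) ts mulVg.
    have rho_d : rho j (t^-1 * s)%g = ((rho j t)^-1 * rho j s)%g.
      by rewrite (rhoM q_gt1 n_odd q_char _ sA) ?rhoV //; apply: subgroupV.
    suff [L1d _] : (L1 `&` Cm j KF) (t^-1 * s)%g.
      by rewrite -[s](mulKVg t); apply: subgroupM.
    have [mu_d dE] := Cm_alpha10 q_gt1 n_odd q_char dC.
    (* The hypothesis on [L1] and [Cm] turns the condition [rho] in [L0] into membership in [L1]. *)
    rewrite L1_Cm; exists (rho j (t^-1 * s)%g) => //; split=> //.
    by rewrite rho_d; apply: subgroupM => //; apply: subgroupV.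
  move=> L1s; have sSC := L1_SlCm _ L1s; split=> //; split.
  - exact: Aut_SlCm.
  - suff [] : (L0 `&` mu (mexp q n)) (rho j s) by [].
    by rewrite -rho_L1; exists s.
  - suff [] : (Lbar `&` piH @` Sl j KF) (piH s) by [].
    by rewrite Lbar_Sl; exists s.
- apply/seteqP; split=> [_ [s [_ _ ?] <-] //|b Lb].
  have [xi L0xi bxi] : [set (xi ^+ mexp q n)%g | xi in L0] (rhobar j b).
    by rewrite -rhobar_Lbar; exists b.
  by have [s Ls [_ sb]] := L_lift b xi Lb L0xi (esym bxi); exists s.
Qed.
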